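(* Let $n\geq 1$ and $1\leq k\leq n$ be integers. (i) The $k$-th coordinate $\lambda_k(n)$ of the vector $\lambda(n)$ is the coefficient of $z^n$ in the generating series $$\prod_{i=1}^\infty\frac{1}{1-z^i}\ \sum_{j=k}^\infty\frac{z^j}{1-z^j}.$$ (ii) The $k$-th coordinate $\gamma_k(n)$ of the vector $\gamma(n)$ is the coefficient of $z^n$ in the generating series $$\frac{(1-z)\,z^k}{(1-z^k)(1-z^{k+1})}\prod_{i=1}^\infty\frac{1}{1-z^i}.$$
   Context: A partition of $n$ is a finite decreasing sequence $\lambda=(\lambda_1\geq\dots\geq\lambda_s>0)$ of positive integers (parts) with sum $\vert\lambda\vert=n$. To a partition $\lambda$ of $n$ one associates the vectors in $\mathbf{Z}^n$: $(\lambda_1,\dots,\lambda_n)$, where $\lambda_k=0$ for $k$ larger than the number of parts; $\nu=(\nu_1,\dots,\nu_n)$, where $\nu_i$ is the number of parts of $\lambda$ equal to $i$; and $\gamma=(\gamma_1,\dots,\gamma_n)$, where $\gamma_i$ is the number of indices $j\in\{1,\dots,n\}$ with $\nu_j=i$. The vectors $\lambda(n)=(\lambda_1(n),\dots,\lambda_n(n))$ and $\gamma(n)=(\gamma_1(n),\dots,\gamma_n(n))$ are obtained by summing over all partitions of $n$: $\lambda_k(n)=\sum_{\vert\lambda\vert=n}\lambda_k$ and $\gamma_k(n)=\sum_{\vert\lambda\vert=n}\gamma_k$. Generating series are formal power series in $z$. *)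

(* Defs.v *)
From HB Require Import structures.
From mathcomp Require Import all_boot all_order all_algebra.
From mathcomp Require Import boolp classical_sets functions cardinality fsbigop.

Set Implicit Arguments.
Unset Strict Implicit.
Unset Printing Implicit Defensive.

Import GRing.Theory.

Local Open Scope ring_scope.

(** * Formal power series *)

Record fps (R : Type) := Fps { coefz : nat -> R }.

HB.instance Definition _ (R : Type) := gen_eqMixin (fps R).
HB.instance Definition _ (R : Type) := gen_choiceMixin (fps R).

Lemma fpsP (R : Type) (f g : fps R) :
  (forall n, coefz f n = coefz g n) -> f = g.
Proof. by case: f g => f [g] /= fg; congr Fps; apply: funext. Qed.

Section FpsRing.
Variable R : comNzRingType.
Implicit Types f g h : fps R.

Definition fps_zero : fps R := Fps (fun=> 0).
Definition fps_opp f : fps R := Fps (fun n => - coefz f n).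
Definition fps_add f g : fps R := Fps (fun n => coefz f n + coefz g n).
Definition fps_one : fps R := Fps (fun n => (n == 0)%N%:R).
Definition fps_mul f g : fps R :=
  Fps (fun n => \sum_(i < n.+1) coefz f i * coefz g (n - i)).

Lemma fps_addA : associative fps_add.
Proof. by move=> f g h; apply: fpsP => n /=; rewrite addrA. Qed.
Lemma fps_addC : commutative fps_add.
Proof. by move=> f g; apply: fpsP => n /=; rewrite addrC. Qed.
Lemma fps_add0 : left_id fps_zero fps_add.
Proof. by move=> f; apply: fpsP => n /=; rewrite add0r. Qed.
Lemma fps_addN : left_inverse fps_zero fps_opp fps_add.
Proof. by move=> f; apply: fpsP => n /=; rewrite addNr. Qed.

HB.instance Definition _ :=
  GRing.isZmodule.Build (fps R) fps_addA fps_addC fps_add0 fps_addN.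

Definition fps_trunc m f : {poly R} := \poly_(i < m) coefz f i.

Lemma coef_fps_mul f g m n : (n < m)%N ->
  coefz (fps_mul f g) n = (fps_trunc m f * fps_trunc m g)`_n.
Proof.
move=> nm; rewrite coefM /=; apply: eq_bigr => i _.
rewrite !coef_poly (leq_ltn_trans (leq_subr _ _) nm).
by rewrite (leq_ltn_trans _ nm) // -ltnS.
Qed.

Lemma fps_mulC : commutative fps_mul.
Proof.
by move=> f g; apply: fpsP => n; rewrite !(@coef_fps_mul _ _ n.+1) // mulrC.
Qed.

Lemma fps_mulA : associative fps_mul.
Proof.
have aux f g h n : coefz (fps_mul f (fps_mul g h)) n =
    (fps_trunc n.+1 f * (fps_trunc n.+1 g * fps_trunc n.+1 h))`_n.
  rewrite coefM /=; apply: eq_bigr => i _.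
  rewrite -(@coef_fps_mul g h n.+1) ?ltnS ?leq_subr //.
  by rewrite coef_poly ltn_ord.
move=> f g h; apply: fpsP => n.
by rewrite aux (fps_mulC (fps_mul f g)) aux mulrA mulrC.
Qed.

Lemma fps_mul1 : left_id fps_one fps_mul.
Proof.
move=> f; apply: fpsP => n /=; rewrite big_ord_recl /= mul1r subn0.
by rewrite big1 ?addr0 // => i _; rewrite mul0r.
Qed.

Lemma fps_mulDl : left_distributive fps_mul +%R.
Proof.
move=> f g h; apply: fpsP => n /=; rewrite -big_split /=.
by apply: eq_bigr => i _; rewrite mulrDl.
Qed.

Lemma fps_one_neq0 : fps_one != 0.
Proof.
by apply/eqP => /(congr1 (fun f => coefz f 0)) /= /eqP; rewrite oner_eq0.
Qed.

HB.instance Definition _ := GRing.Zmodule_isComNzRing.Build (fps R)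
  fps_mulA fps_mulC fps_mul1 fps_mulDl fps_one_neq0.

(* A series is a unit when it has an inverse; following the library
   convention, [f^-1] is [f] itself when [f] is not a unit. *)
Definition fps_unit : {pred fps R} := fun f => `[< exists g, g * f = 1 >].
Definition fps_inv f : fps R := xget f [set g | g * f = 1]%classic.

Lemma fps_mulV : {in fps_unit, left_inverse 1 fps_inv *%R}.
Proof. by move=> f /asboolP; apply: xgetPex. Qed.

Lemma fps_unitPl f g : g * f = 1 -> fps_unit f.
Proof. by move=> gf; apply/asboolP; exists g. Qed.

Lemma fps_inv_out : {in [predC fps_unit], fps_inv =1 id}.
Proof.
move=> f /asboolPn nf; apply: xgetPN => g gf.
by apply: nf; exists g.
Qed.

HB.instance Definition _ := GRing.ComNzRing_hasMulInverse.Build (fps R)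
  fps_mulV fps_unitPl fps_inv_out.

Definition fpsz : fps R := Fps (fun n => (n == 1)%N%:R).

(* Convergence in the z-adic topology: every coefficient is eventually
   constant. *)
Definition fps_cvg (u : nat -> fps R) (l : fps R) : Prop :=
  forall n, exists N, forall m, (N <= m)%N -> coefz (u m) n = coefz l n.

(* The limit of [u], or [0] when [u] does not converge. *)
Definition fps_lim (u : nat -> fps R) : fps R := xget 0 (fps_cvg u).

Lemma fps_cvg_unique u : is_subset1 (fps_cvg u).
Proof.
move=> l l' ul ul'; apply: fpsP => n.
have [N lN] := ul n; have [N' lN'] := ul' n.
by rewrite -(lN (maxn N N')) ?leq_maxl // -(lN' (maxn N N')) // leq_maxr.
Qed.

Lemma fps_cvg_lim u l : fps_cvg u l -> fps_lim u = l.
Proof. by move=> ul; apply: (xget_subset1 _ ul); exact: fps_cvg_unique. Qed.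

Definition fps_series (k : nat) (f : nat -> fps R) : fps R :=
  fps_lim (fun m => \sum_(k <= i < m) f i).

Definition fps_infprod (k : nat) (f : nat -> fps R) : fps R :=
  fps_lim (fun m => \prod_(k <= i < m) f i).

End FpsRing.

(** * Partitions *)

Definition partition_of (n : nat) : set (seq nat) :=
  [set s | [/\ sorted geq s, all (leq 1) s & sumn s = n]]%classic.

(* Sums over [partition_of n] below are finitely supported sums; they would be
   [0] by convention on an infinite support. *)
Lemma finite_partition_of n : finite_set (partition_of n).
Proof.
pose F (s : n.-bseq 'I_n.+1) : seq nat := map val s.
apply: (@sub_finite_set _ _ (F @` setT)%classic); last first.
  exact/finite_image/finite_finset.
move=> s [_ s_gt0 s_sum].
have le_size : (size s <= n)%N.
  rewrite -s_sum; elim: s s_gt0 {s_sum} => //= x s IHs /andP[x0 /IHs].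
  by rewrite -add1n; exact: leq_add.
have s_le : all (fun x => x < n.+1)%N s.
  apply/allP => x; rewrite ltnS -s_sum => {s_gt0 s_sum le_size}.
  elim: s => //= y s IHs; rewrite inE => /predU1P[->|/IHs]; first exact: leq_addr.
  by move=> /leq_trans; apply; exact: leq_addl.
have sz : (size (map (@inord n) s) <= n)%N by rewrite size_map.
exists (Bseq sz) => //=; rewrite /F /= -map_comp -[RHS]map_id.
by apply/eq_in_map => x /(allP s_le) /= /inordK.
Qed.

(* The coordinates are numbered from 1. *)
Definition part_lambda (s : seq nat) (k : nat) : nat := nth 0%N s k.-1.

Definition part_nu (s : seq nat) (i : nat) : nat := count_mem i s.

Definition part_gamma (n : nat) (s : seq nat) (i : nat) : nat :=
  count (fun j => part_nu s j == i) (iota 1 n).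

Definition lambda_vec (n k : nat) : int :=
  \sum_(s \in partition_of n) (part_lambda s k)%:Z.

Definition gamma_vec (n k : nat) : int :=
  \sum_(s \in partition_of n) (part_gamma n s k)%:Z.

(* Main.v *)
Require Import Defs.
From mathcomp Require Import all_boot all_order all_algebra.
From mathcomp Require Import boolp classical_sets functions cardinality fsbigop.
From mathcomp Require Import ring.

Set Implicit Arguments.
Unset Strict Implicit.
Unset Printing Implicit Defensive.

Import GRing.Theory.

Local Open Scope ring_scope.

(** Attach to a weight [w] on partitions the series whose coefficient of
    [z ^+ n] is the sum of [w] over the partitions of [n]. Inserting one part
    equal to [j] is a bijection from the partitions of [n] onto the partitions
    of [j + n] that contain [j]; hence, when [w] vanishes on the partitions
    without part [j], its series is [z ^+ j] times that of the weight
    [w (insert_part j s)] ([partition_gf_insert]). Three instances carry the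
    proof.
    - Applied to the partitions with parts at most [m] that contain [m], it
      gives Euler's product for the series [euler_gf] of the weight 1
      ([euler_product]).
    - Applied to the multiplicity of [j], which insertion raises by 1, it gives
      the series [z ^+ j / (1 - z ^+ j) * euler_gf] ([partition_gf_nu]).
    - Applied [k] times, it shows that the partitions containing [j] at least
      [k] times have the series [z ^+ (j * k) * euler_gf]
      ([partition_gf_nu_geq]).

    For (i), conjugation of Young diagrams exchanges the [k]-th largest part
    with the number of parts that are at least [k] ([lambda_vec_count]), which
    is the sum of the multiplicities of all [j >= k]; the second instance
    concludes.

    For (ii), the indicator of [nu_j = k] is the difference of those of
    [nu_j >= k] and [nu_j >= k + 1]. Summing the third instance over [j] yields
    geometric series of ratios [z ^+ k] and [z ^+ k.+1], and the difference
    [z ^+ k / (1 - z ^+ k) - z ^+ k.+1 / (1 - z ^+ k.+1)] is the announced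
    rational function ([geom_difference]). In degree [n] only the [j <= n]
    matter, so that finite sums suffice throughout. *)

(** * Formal power series *)

Section FormalSeries.
Variable R : comNzRingType.
Implicit Types f g h : fps R.
Local Notation z := (fpsz R).

Lemma coefzB f g n : coefz (f - g) n = coefz f n - coefz g n.
Proof. by []. Qed.

Lemma coefzM f g n :
  coefz (f * g) n = \sum_(i < n.+1) coefz f i * coefz g (n - i).
Proof. by []. Qed.

Lemma coefz_sum (I : Type) (r : seq I) (F : I -> fps R) n :
  coefz (\sum_(i <- r) F i) n = \sum_(i <- r) coefz (F i) n.
Proof. exact: (big_morph (fun f => coefz f n)). Qed.

Lemma coefz_zXM j f n :
  coefz (z ^+ j * f) n = if (n < j)%N then 0 else coefz f (n - j).
Proof.
elim: j n => [|j IHj] n; first by rewrite expr0 mul1r subn0.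
rewrite exprS -mulrA; move: (z ^+ j * f) IHj => g IHj.
case: n => [|n]; first by rewrite /= big_ord1 mul0r.
rewrite ltnS /= !big_ord_recl /= mul0r add0r mul1r.
rewrite [(_ - bump 0 0)%N]subn1 IHj subSS.
by rewrite big1 ?addr0 // => i _; rewrite mul0r.
Qed.

Lemma eq_coefz_mulr f g h n :
  (forall i, (i <= n)%N -> coefz g i = coefz h i) ->
  coefz (f * g) n = coefz (f * h) n.
Proof. by move=> gh; apply: eq_bigr => i _; rewrite gh // leq_subr. Qed.

(** The inverse is the geometric series in [z ^+ j], whose coefficients are the
    indicator of the multiples of [j]. *)
Lemma unit_1subzX j : (0 < j)%N -> 1 - z ^+ j \is a GRing.unit.
Proof.
move=> j_gt0; apply/unitrPr; exists (Fps (fun n => (j %| n)%N%:R)).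
apply: fpsP => n; rewrite mulrBl mul1r coefzB coefz_zXM /=.
have [n_lt_j | j_le_n] := ltnP n j.
  rewrite subr0; case: n n_lt_j => [|n] n_lt_j; first by rewrite dvdn0.
  by rewrite gtnNdvd.
rewrite dvdn_subl // subrr; case: n j_le_n => // j0.
by move: j_gt0; rewrite ltnNge j0.
Qed.

(** The terms with [j > n] do not reach degree [n], so the series converges and
    its coefficient of [z ^+ n] is that of any long enough partial sum. *)
Lemma coefz_series k (g : nat -> fps R) m n : (n < m)%N ->
  coefz (fps_series k (fun j => z ^+ j * g j)) n
    = coefz (\sum_(k <= j < m) z ^+ j * g j) n.
Proof.
have stable M N : (N < M)%N ->
    coefz (\sum_(k <= j < M) z ^+ j * g j) N
      = \sum_(k <= j < N.+1) coefz (z ^+ j * g j) N.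
  move=> NM; rewrite coefz_sum (big_nat_widen _ _ _ _ _ NM) [RHS]big_mkcond.
  by apply: eq_bigr => j _; rewrite coefz_zXM ltnS; case: leqP.
move=> nm; pose S := Fps (fun N => \sum_(k <= j < N.+1) coefz (z ^+ j * g j) N).
rewrite stable // /fps_series (@fps_cvg_lim _ _ S) // => N.
by exists N.+1 => M NM; rewrite stable.
Qed.

End FormalSeries.

(** * Inserting a part into a partition *)

Definition insert_part (j : nat) (s : seq nat) : seq nat := sort geq (j :: s).

Lemma geq_trans : transitive geq.
Proof. by move=> b a c /= ab bc; apply: leq_trans bc ab. Qed.

Lemma geq_anti : antisymmetric geq.
Proof. by move=> a b; rewrite /= andbC; apply: anti_leq. Qed.

Lemma geq_total : total geq.
Proof. by move=> a b; apply: leq_total. Qed.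

Lemma perm_insert_part j s : perm_eq (insert_part j s) (j :: s).
Proof. by rewrite perm_sort. Qed.

Lemma count_insert_part a j s : count a (insert_part j s) = (a j + count a s)%N.
Proof. by rewrite (permP (perm_insert_part j s)). Qed.

Lemma all_insert_part a j s : all a (insert_part j s) = a j && all a s.
Proof. by rewrite (perm_all _ (perm_insert_part j s)). Qed.

(** The inverse bijection removes one copy of [j]; sortedness makes a partition
    the only representative of its multiset of parts. *)
Lemma insert_part_bij n j : (0 < j)%N ->
  set_bij (partition_of n)
    [set s | partition_of (j + n) s /\ j \in s]%classic (insert_part j).
Proof.
move=> j_gt0; split.
- move=> s [s_sorted s_pos s_sum]; split; last first.
    by rewrite (perm_mem (perm_insert_part j s)) mem_head.
  split; first exact: (sort_sorted geq_total).
    by rewrite all_insert_part j_gt0.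
  by rewrite (perm_sumn (perm_insert_part j s)) /= s_sum.
- move=> s t /set_mem[s_sorted _ _] /set_mem[t_sorted _ _] st.
  apply: (sorted_eq geq_trans geq_anti) => //.
  rewrite -(perm_cons j) -(permPl (perm_insert_part j s)) st.
  exact: perm_insert_part.
- move=> t [[t_sorted t_pos t_sum] jt].
  have t_perm := perm_to_rem jt; exists (rem j t); last first.
    apply: (sorted_eq geq_trans geq_anti) => //.
      exact: (sort_sorted geq_total).
    by rewrite (permPl (perm_insert_part _ _)) perm_sym.
  split.
  + exact: (subseq_sorted geq_trans (rem_subseq j t)).
  + by move: t_pos; rewrite (perm_all _ t_perm) /= j_gt0.
  + by move: t_sum; rewrite (perm_sumn t_perm) /= => /addnI.
Qed.

Lemma leq_partition n s j : partition_of n s -> j \in s -> (j <= n)%N.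
Proof.
move=> [_ _ <-] js; rewrite (perm_sumn (perm_to_rem js)) /=.
exact: leq_addr.
Qed.

(** * Weighted generating series of partitions *)

Definition partition_gf (w : seq nat -> int) : fps int :=
  Fps (fun n => \sum_(s \in partition_of n) w s).

Local Notation z := (fpsz int).

Lemma eq_coefz_partition_gf v w n :
  (forall s, partition_of n s -> v s = w s) ->
  coefz (partition_gf v) n = coefz (partition_gf w) n.
Proof. by move=> vw; apply: eq_fsbigr => s /set_mem; exact: vw. Qed.

Lemma eq_partition_gf v w : v =1 w -> partition_gf v = partition_gf w.
Proof. by move=> /funext ->. Qed.

Lemma partition_gfD v w :
  partition_gf (fun s => v s + w s) = partition_gf v + partition_gf w.
Proof.
by apply: fpsP => n; apply: fsbig_split; exact: finite_partition_of.
Qed.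

Lemma partition_gfB v w :
  partition_gf (fun s => v s - w s) = partition_gf v - partition_gf w.
Proof.
apply/(canRL (addrK _)); rewrite -partition_gfD.
by apply: eq_partition_gf => s; rewrite subrK.
Qed.

Lemma partition_gf_sum (I : Type) (r : seq I) (w : I -> seq nat -> int) :
  partition_gf (fun s => \sum_(i <- r) w i s)
    = \sum_(i <- r) partition_gf (w i).
Proof.
elim: r => [|i r IHr].
  rewrite big_nil; apply: fpsP => n; apply: fsbig1 => s _.
  by rewrite big_nil.
rewrite big_cons -IHr -partition_gfD.
by apply: eq_partition_gf => s; rewrite big_cons.
Qed.

(** Every partition containing the part [j] arises from exactly one partition,
    smaller by [j], by inserting this part. All the functional equations below
    are instances of this identity. *)
Lemma partition_gf_insert j w : (0 < j)%N ->
    (forall s, j \notin s -> w s = 0) ->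
  partition_gf w = z ^+ j * partition_gf (fun s => w (insert_part j s)).
Proof.
move=> j_gt0 w0; apply: fpsP => n; rewrite coefz_zXM.
case: ltnP => [n_lt_j | j_le_n].
  apply: fsbig1 => s s_n; apply: w0; apply/negP => /(leq_partition s_n).
  by rewrite leqNgt n_lt_j.
rewrite [RHS](_ : _ = \sum_(s \in partition_of (n - j)) w (insert_part j s)) //.
rewrite -(reindex_fsbig _ _ _ w (insert_part_bij (n - j) j_gt0)) subnKC //.
apply/esym/fsbig_widen => [s [] // | s [s_n /= s_j]].
by apply: w0; apply/negP => js; apply: s_j.
Qed.

(** * The Euler product *)

Definition parts_leq_gf m : fps int :=
  partition_gf (fun s => (all (geq m) s)%:R).

Definition euler_gf : fps int := partition_gf (fun=> 1).

(** The only partition without parts is the empty one. *)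
Lemma parts_leq_gf0 : parts_leq_gf 0 = 1.
Proof.
apply: fpsP => n; rewrite [RHS]/= /parts_leq_gf /=.
case: n => [|n].
  rewrite (_ : partition_of 0 = [set [::]]%classic) ?fsbig_set1 //.
  apply/seteqP; split=> [[|[|x] s] [] //|_ ->]; by split.
apply: fsbig1 => -[|[|x] s] [] //.
Qed.

(** Either [m.+1] is not a part, or one copy of it can be removed. *)
Lemma parts_leq_gfS m :
  parts_leq_gf m.+1 * (1 - z ^+ m.+1) = parts_leq_gf m.
Proof.
rewrite mulrBr mulr1 [_ * z ^+ _]mulrC; apply/eqP.
rewrite subr_eq addrC -subr_eq.
rewrite -partition_gfB (@partition_gf_insert m.+1) //; last first.
  move=> s m_s; apply/eqP; rewrite subr_eq0; apply/eqP; congr (_%:R).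
  congr (nat_of_bool _); apply: eq_in_all => x xs /=; rewrite leq_eqVlt ltnS.
  by case: eqP => // x_m; rewrite -x_m xs in m_s.
apply/eqP; congr (_ * _); apply: eq_partition_gf => s.
by rewrite !all_insert_part /= leqnn ltnn subr0.
Qed.

Lemma prod_geom_parts_leq_gf m :
  \prod_(1 <= i < m.+1) (1 / (1 - z ^+ i)) = parts_leq_gf m.
Proof.
elim: m => [|m IHm]; first by rewrite big_geq // parts_leq_gf0.
rewrite big_nat_recr //= IHm -parts_leq_gfS mul1r mulrK //.
exact: unit_1subzX.
Qed.

(** The parts of a partition of [n] are at most [n], so the coefficient of
    [z ^+ n] is stationary in the partial products. *)
Lemma euler_product : fps_infprod 1 (fun i => 1 / (1 - z ^+ i)) = euler_gf.
Proof.
apply: fps_cvg_lim => n; exists n.+1 => -[//|m] n_le_m.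
rewrite prod_geom_parts_leq_gf; apply: eq_coefz_partition_gf => s s_n.
rewrite (_ : all _ _ = true) //; apply/allP => x /(leq_partition s_n) /= x_n.
exact: leq_trans x_n _.
Qed.

(** * Multiplicities of parts *)

Lemma notin_part_nu0 j s : j \notin s -> part_nu s j = 0%N.
Proof. by move/count_memPn. Qed.

Lemma part_nu_insert j s : part_nu (insert_part j s) j = (part_nu s j).+1.
Proof. by rewrite /part_nu count_insert_part /= eqxx. Qed.

(** Inserting [j] raises its multiplicity by one, so the series [N] satisfies
    [N = z ^+ j * (N + euler_gf)]. *)
Lemma partition_gf_nu j : (0 < j)%N ->
  partition_gf (fun s => (part_nu s j)%:R)
    = z ^+ j / (1 - z ^+ j) * euler_gf.
Proof.
move=> j_gt0; set N := partition_gf _.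
have NE : N = z ^+ j * (euler_gf + N).
  rewrite {1}/N (@partition_gf_insert j) // => [|s /notin_part_nu0 -> //].
  rewrite -partition_gfD; congr (_ * _); apply: eq_partition_gf => s.
  by rewrite part_nu_insert -natr1 addrC.
have u := unit_1subzX int j_gt0.
apply: (mulIr u); rewrite mulrAC divrK //.
by rewrite mulrBr mulr1 {1}NE; ring.
Qed.

(** Removing one copy of [j] lowers the threshold [k.+1] to [k]. *)
Lemma partition_gf_nu_geq j k : (0 < j)%N ->
  partition_gf (fun s => (k <= part_nu s j)%:R) = z ^+ (j * k) * euler_gf.
Proof.
move=> j_gt0; elim: k => [|k IHk].
  by rewrite muln0 mul1r; apply: eq_partition_gf.
rewrite (@partition_gf_insert j) // => [|s /notin_part_nu0 -> //].
rewrite mulnS exprD -mulrA -IHk; congr (_ * _); apply: eq_partition_gf => s.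
by rewrite part_nu_insert.
Qed.

(** * Conjugation *)

Definition conj_part (s : seq nat) : seq nat :=
  mkseq (fun i => count (ltn i) s) (head 0%N s).

(** A cell [(i, j)] belongs to the Young diagram when its column index is less
    than the length of its row, equivalently when its row index is less than
    the length of its column. *)
Lemma ltn_count_gtn s i j : sorted geq s ->
  (i < count (ltn j) s)%N = (j < nth 0%N s i)%N.
Proof.
elim: s i => [|x s IHs] i; first by rewrite nth_nil.
rewrite /= (path_sortedE geq_trans) => /andP[s_x s_sorted].
have [j_x | x_j] := ltnP j x.
  by case: i => [|i] //=; rewrite -IHs.
rewrite [count _ _](_ : _ = 0)%N; last first.
  apply/eqP; rewrite -leqn0 leqNgt -has_count; apply/hasPn => y /(allP s_x) /=.
  by move=> y_x; rewrite -leqNgt (leq_trans y_x).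
case: i => [|i] /=; first by rewrite ltnn ltnNge x_j.
apply/esym/negbTE; rewrite -leqNgt; apply: leq_trans x_j.
have [i_s | s_i] := ltnP i (size s); last by rewrite nth_default.
exact: (allP s_x) (mem_nth 0%N i_s).
Qed.

Lemma nth_conj_part s i : sorted geq s ->
  nth 0%N (conj_part s) i = count (ltn i) s.
Proof.
move=> s_sorted; have [i_lt | i_ge] := ltnP i (head 0%N s).
  by rewrite nth_mkseq.
rewrite nth_default ?size_mkseq //; apply/esym/eqP; rewrite -leqn0 leqNgt.
by rewrite ltn_count_gtn // nth0 -leqNgt.
Qed.

Lemma sorted_conj_part s : sorted geq (conj_part s).
Proof.
apply: (homo_sorted (e := ltn)); last exact: iota_ltn_sorted.
by move=> a b /= ab; apply: sub_count => x /=; apply: ltn_trans.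
Qed.

(** Both sides count the cells of the Young diagram, by columns and by rows. *)
Lemma sumn_conj_part s : sorted geq s -> sumn (conj_part s) = sumn s.
Proof.
move=> s_sorted; rewrite !sumnE big_map.
under eq_bigr do rewrite -sum1_count big_mkcond.
rewrite exchange_big /=; apply: eq_big_seq => x xs.
have x_le : (x <= head 0 s)%N.
  case: s xs s_sorted => //= y s; rewrite inE (path_sortedE geq_trans).
  by move=> /predU1P[-> // | xs] /andP[/allP/(_ x xs)].
have -> : iota 0 (head 0%N s) = index_iota 0 (head 0%N s).
  by rewrite /index_iota subn0.
rewrite -big_mkcond -(big_nat_widen 0 x _ xpredT (fun=> 1%N) x_le).
by rewrite sum_nat_const_nat subn0 muln1.
Qed.

Lemma conj_part_partition n s :
  partition_of n s -> partition_of n (conj_part s).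
Proof.
move=> [s_sorted s_pos <-].
split; [exact: sorted_conj_part | | exact: sumn_conj_part].
apply/allP => y /mapP[i]; rewrite mem_iota add0n => /= i_lt ->.
by rewrite ltn_count_gtn // nth0.
Qed.

Lemma eq_from_ltn a b : (forall j, (j < a)%N = (j < b)%N) -> a = b.
Proof.
move=> ab; have := ab a; have := ab b; rewrite !ltnn => b_a a_b.
by apply/eqP; rewrite eqn_leq leqNgt b_a leqNgt -a_b.
Qed.

Lemma conj_partK n s : partition_of n s -> conj_part (conj_part s) = s.
Proof.
move=> [s_sorted s_pos _]; have c_sorted := sorted_conj_part s.
apply: (@eq_from_nth _ 0%N) => [|i _].
  rewrite size_mkseq -nth0 nth_conj_part //.
  by apply/eqP; rewrite -all_count.
(* Both numbers have the same strict lower bounds: transpose twice. *)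
rewrite nth_conj_part //; apply: eq_from_ltn => j.
by rewrite ltn_count_gtn // nth_conj_part // ltn_count_gtn.
Qed.

Lemma conj_part_bij n : set_bij (partition_of n) (partition_of n) conj_part.
Proof.
split; first exact: conj_part_partition.
- by move=> s t /set_mem/conj_partK {2}<- /set_mem/conj_partK {2}<- ->.
- move=> s s_n; exists (conj_part s); first exact: conj_part_partition.
  exact: conj_partK s_n.
Qed.

(** By conjugation, the [k]-th largest part has the same distribution as the
    number of parts that are at least [k]. *)
Lemma lambda_vec_count n k : (0 < k)%N ->
  lambda_vec n k = coefz (partition_gf (fun s => (count (leq k) s)%:R)) n.
Proof.
move=> k_gt0; rewrite /lambda_vec (reindex_fsbig _ _ _ _ (conj_part_bij n)).
apply: eq_fsbigr => s /set_mem[s_sorted _ _].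
by rewrite /part_lambda nth_conj_part // natz; case: k k_gt0.
Qed.

Lemma count_leq_sum_nu n k s : partition_of n s ->
  count (leq k) s = (\sum_(k <= j < n.+1) part_nu s j)%N.
Proof.
move=> s_n; under eq_bigr do rewrite /part_nu -sum1_count big_mkcond.
rewrite exchange_big -sum1_count big_mkcond; apply: eq_big_seq => x xs /=.
have x_le := leq_partition s_n xs.
rewrite -big_mkcond /=.
under eq_bigl do rewrite eq_sym.
rewrite big_nat1_eq ltnS x_le andbT.
by case: (k <= x)%N.
Qed.

(** * Telescoping *)

Lemma sum_zX_mul n k :
  (\sum_(1 <= j < n.+1) z ^+ (j * k)) * (1 - z ^+ k)
    = z ^+ k - z ^+ (n.+1 * k).
Proof.
have := telescope_sumr (fun j => - z ^+ (j * k)) (ltn0Sn n).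
rewrite mul1n opprK addrC => <-; rewrite mulr_suml.
by apply: eq_bigr => j _; rewrite mulSn exprD; ring.
Qed.

(** The remainder of the truncated geometric series is divisible by
    [z ^+ (n.+1 * k)], hence invisible in degree [n]. *)
Lemma coefz_sum_zX_mul n k f : (0 < k)%N ->
  coefz ((\sum_(1 <= j < n.+1) z ^+ (j * k)) * f) n
    = coefz (z ^+ k / (1 - z ^+ k) * f) n.
Proof.
move=> k_gt0; have u := unit_1subzX int k_gt0.
rewrite -[X in X * f](mulrK u) sum_zX_mul !mulrBl -!mulrA.
by rewrite coefzB [X in _ - X]coefz_zXM leq_pmulr // subr0.
Qed.

Lemma geom_difference k : (0 < k)%N ->
  z ^+ k / (1 - z ^+ k) - z ^+ k.+1 / (1 - z ^+ k.+1)
    = (1 - z) * z ^+ k / ((1 - z ^+ k) * (1 - z ^+ k.+1)).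
Proof.
move=> k_gt0; have u := unit_1subzX int k_gt0.
have v := unit_1subzX int (ltn0Sn k).
apply: (mulIr (x := (1 - z ^+ k) * (1 - z ^+ k.+1))); first by rewrite unitrM u.
rewrite divrK ?unitrM ?u // mulrBl {1}mulrA divrK // [X in _ - _ * X]mulrC.
by rewrite [X in _ - X]mulrA divrK // exprS; ring.
Qed.

Lemma part_gammaE n k s :
  (part_gamma n s k)%:R
    = \sum_(1 <= j < n.+1)
        ((k <= part_nu s j)%:R - (k.+1 <= part_nu s j)%:R) :> int.
Proof.
rewrite /part_gamma -sum1_count natr_sum big_mkcond /index_iota subSS subn0.
by apply: eq_bigr => j _; case: (ltngtP (part_nu s j) k).
Qed.

Theorem corollary1p4 (n k : nat) (hn : (1 <= n)%N) (hk : (1 <= k)%N)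
    (hkn : (k <= n)%N) :
  let z : fps int := fpsz int in
  let P : fps int := fps_infprod 1 (fun i => 1 / (1 - z ^+ i)) in
  lambda_vec n k
    = coefz (P * fps_series k (fun j => z ^+ j / (1 - z ^+ j))) n
  /\ gamma_vec n k
    = coefz ((1 - z) * z ^+ k / ((1 - z ^+ k) * (1 - z ^+ k.+1)) * P) n.
Proof.
move=> z P; rewrite {}/P euler_product; split.
- rewrite lambda_vec_count //.
  transitivity (coefz (partition_gf
      (fun s => \sum_(k <= j < n.+1) (part_nu s j)%:R)) n).
    apply: eq_coefz_partition_gf => s s_n.
    by rewrite (count_leq_sum_nu k s_n) natr_sum.
  rewrite partition_gf_sum.
  transitivity (coefz (euler_gf *
      \sum_(k <= j < n.+1) z ^+ j / (1 - z ^+ j)) n).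
    rewrite mulr_sumr; congr (coefz _ n); apply: eq_big_nat => j /andP[k_j _].
    by rewrite partition_gf_nu ?(leq_trans hk) // mulrC.
  by apply/esym/eq_coefz_mulr => i i_n; rewrite (@coefz_series _ _ _ n.+1).
- transitivity (coefz (partition_gf (fun s => (part_gamma n s k)%:R)) n).
    by apply: eq_fsbigr => s _; rewrite natz.
  rewrite (eq_partition_gf (part_gammaE n k)) partition_gf_sum.
  rewrite -geom_difference // mulrBl.
  transitivity (coefz ((\sum_(1 <= j < n.+1) z ^+ (j * k)) * euler_gf
      - (\sum_(1 <= j < n.+1) z ^+ (j * k.+1)) * euler_gf) n).
    rewrite !mulr_suml -sumrB; congr (coefz _ n); apply: eq_big_nat => j.
    by move=> /andP[j_gt0 _]; rewrite partition_gfB !partition_gf_nu_geq.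
  by congr (_ - _); apply: coefz_sum_zX_mul.
Qed.
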